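(* Let $L$ be a finite relational language and let $K$ be the class of finite $L$-structures (here the empty structure is allowed as a member of $K$). Let $\mathcal{A}\in K$. (1) If $\mathcal{A}$ is empty, then $I(\mathcal{A})$ is $m$-complete $\Pi^0_1$ within $K$. (2) If $\mathcal{A}$ has size $n\ge 1$, then $I(\mathcal{A})$ is $m$-complete $d$-c.e. within $K$.
   Context: Structures have universes contained in $\omega$ and are identified with their atomic diagrams $D(\mathcal{A})$; $\mathcal{A}$ is computable if $D(\mathcal{A})$ is computable. Let $(\varphi_a)_{a\in\omega}$ be a standard computable enumeration of the unary partial computable functions. An index for a computable structure $\mathcal{A}$ is a number $a$ with $\varphi_a=\chi_{D(\mathcal{A})}$. The index set $I(\mathcal{A})$ is the set of all indices of computable structures isomorphic to $\mathcal{A}$; for a class $K$ closed under isomorphism, $I(K)$ is the set of indices of computable members of $K$. For a complexity class $\Gamma$ (e.g. $\Pi^0_1$, or $d$-c.e. = the class of sets $S_1-S_2$ with $S_1,S_2$ c.e.), $I(\mathcal{A})$ is $\Gamma$ within $K$ if $I(\mathcal{A})=R\cap I(K)$ for some $R\in\Gamma$, and it is $m$-complete $\Gamma$ within $K$ if it is $\Gamma$ within $K$ and for every $S\in\Gamma$ there is a computable $f:\omega\to I(K)$ with $n\in S$ iff $f(n)\in I(\mathcal{A})$ (equivalently, a uniformly computable sequence $(\mathcal{C}_n)$ of members of $K$ with $n\in S$ iff $\mathcal{C}_n\cong\mathcal{A}$). *)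

(* Defs.v *)
From HB Require Import structures.
From mathcomp Require Import all_boot.
Set Implicit Arguments. Unset Strict Implicit. Unset Printing Implicit Defensive.

(* Pairing  <x, y> = 2^x * (2y+1) - 1, a bijection nat * nat -> nat. *)
Definition npair (x y : nat) : nat := (2 ^ x * (2 * y + 1)).-1.
Definition nfst (z : nat) : nat := logn 2 z.+1.
Definition nsnd (z : nat) : nat := (z.+1 %/ 2 ^ nfst z).-1./2.

(* Codes of unary partial recursive functions (basis: zero, successor,
   projections of the pairing, pairing, composition, primitive recursion
   and unbounded minimisation, all in unary form via the pairing). *)
Inductive pcode : Type :=
| cZero | cSucc | cFst | cSnd
| cPair of pcode & pcode
| cComp of pcode & pcode
| cPrec of pcode & pcode
| cMu of pcode.

Fixpoint pcode_enc (c : pcode) : GenTree.tree nat :=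
  match c with
  | cZero => GenTree.Node 0 [::]
  | cSucc => GenTree.Node 1 [::]
  | cFst => GenTree.Node 2 [::]
  | cSnd => GenTree.Node 3 [::]
  | cPair f g => GenTree.Node 4 [:: pcode_enc f; pcode_enc g]
  | cComp f g => GenTree.Node 5 [:: pcode_enc f; pcode_enc g]
  | cPrec f g => GenTree.Node 6 [:: pcode_enc f; pcode_enc g]
  | cMu f => GenTree.Node 7 [:: pcode_enc f]
  end.

Fixpoint pcode_dec (t : GenTree.tree nat) : option pcode :=
  match t with
  | GenTree.Node 0 [::] => Some cZero
  | GenTree.Node 1 [::] => Some cSucc
  | GenTree.Node 2 [::] => Some cFst
  | GenTree.Node 3 [::] => Some cSnd
  | GenTree.Node 4 [:: t1; t2] =>
      obind (fun f => omap (cPair f) (pcode_dec t2)) (pcode_dec t1)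
  | GenTree.Node 5 [:: t1; t2] =>
      obind (fun f => omap (cComp f) (pcode_dec t2)) (pcode_dec t1)
  | GenTree.Node 6 [:: t1; t2] =>
      obind (fun f => omap (cPrec f) (pcode_dec t2)) (pcode_dec t1)
  | GenTree.Node 7 [:: t1] => omap cMu (pcode_dec t1)
  | _ => None
  end.

Lemma pcode_encK : pcancel pcode_enc pcode_dec.
Proof. by elim=> //= f -> // g ->. Qed.

HB.instance Definition _ := Countable.copy pcode (pcan_type pcode_encK).

Inductive peval : pcode -> nat -> nat -> Prop :=
| evZero x : peval cZero x 0
| evSucc x : peval cSucc x x.+1
| evFst x : peval cFst x (nfst x)
| evSnd x : peval cSnd x (nsnd x)
| evPair f g x a b :
    peval f x a -> peval g x b -> peval (cPair f g) x (npair a b)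
| evComp f g x y z : peval g x y -> peval f y z -> peval (cComp f g) x z
| evPrec0 f g x y : peval f x y -> peval (cPrec f g) (npair x 0) y
| evPrecS f g x n y z :
    peval (cPrec f g) (npair x n) y -> peval g (npair x (npair n y)) z ->
    peval (cPrec f g) (npair x n.+1) z
| evMu f x n :
    peval f (npair x n) 0 ->
    (forall m, m < n -> exists k, peval f (npair x m) k.+1) ->
    peval (cMu f) x n.

Definition phi (a : nat) : nat -> nat -> Prop :=
  peval (odflt cZero (unpickle a)).

Definition halts (a x : nat) : Prop := exists y, phi a x y.

Definition ce (S : nat -> Prop) : Prop := exists a, forall x, S x <-> halts a x.
Definition Pi01 (S : nat -> Prop) : Prop :=
  exists T, ce T /\ forall x, S x <-> ~ T x.
Definition dce (S : nat -> Prop) : Prop :=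
  exists S1 S2, ce S1 /\ ce S2 /\ forall x, S x <-> (S1 x /\ ~ S2 x).

Definition computable_fun (f : nat -> nat) : Prop :=
  exists e, forall x, phi e x (f x).

(* A finite relational language is the list of arities of its relation
   symbols: symbol i (i < size L) has arity nth 0 L i. *)
Definition language := seq nat.

Record structure (L : language) := Structure {
  sdom : nat -> Prop;
  srel : nat -> seq nat -> Prop }.

Inductive atom : Type :=
| AEq of nat & nat
| ARel of nat & seq nat.

Definition atom_enc (s : atom) : (nat * nat) + (nat * seq nat) :=
  match s with AEq x y => inl (x, y) | ARel i xs => inr (i, xs) end.
Definition atom_dec (u : (nat * nat) + (nat * seq nat)) : atom :=
  match u with inl (x, y) => AEq x y | inr (i, xs) => ARel i xs end.
Lemma atom_encK : cancel atom_enc atom_dec. Proof. by case. Qed.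
HB.instance Definition _ := Countable.copy atom (can_type atom_encK).

Definition holds (L : language) (A : structure L) (s : atom) : Prop :=
  match s with
  | AEq x y => sdom A x /\ sdom A y /\ x = y
  | ARel i xs => i < size L /\ size xs = nth 0 L i /\
                 (forall x, x \in xs -> sdom A x) /\ srel A i xs
  end.

Definition diagram (L : language) (A : structure L) (n : nat) : Prop :=
  exists s : atom, pickle s = n /\ holds A s.

Definition is_index (L : language) (a : nat) (A : structure L) : Prop :=
  forall n, (diagram A n -> phi a n 1) /\ (~ diagram A n -> phi a n 0).

Definition iso (L : language) (A B : structure L) : Prop :=
  exists f : nat -> nat,
    (forall x, sdom A x -> sdom B (f x)) /\
    (forall x y, sdom A x -> sdom A y -> f x = f y -> x = y) /\
    (forall y, sdom B y -> exists2 x, sdom A x & f x = y) /\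
    (forall i xs, i < size L -> size xs = nth 0 L i ->
        (forall x, x \in xs -> sdom A x) ->
        (srel A i xs <-> srel B i (map f xs))).

Definition finite_str (L : language) (A : structure L) : Prop :=
  exists s : seq nat, forall x, sdom A x <-> x \in s.

Definition has_size (L : language) (A : structure L) (n : nat) : Prop :=
  exists s : seq nat, [/\ uniq s, size s = n & forall x, sdom A x <-> x \in s].

Definition empty_str (L : language) (A : structure L) : Prop :=
  forall x, ~ sdom A x.

Definition index_set (L : language) (A : structure L) (a : nat) : Prop :=
  exists B : structure L, is_index a B /\ iso B A.
Definition index_set_K (L : language) (a : nat) : Prop :=
  exists B : structure L, finite_str B /\ is_index a B.

Definition within_K (L : language) (Gamma : (nat -> Prop) -> Prop)
    (P : nat -> Prop) : Prop :=
  exists R, Gamma R /\ forall a, P a <-> (R a /\ index_set_K L a).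

Definition m_complete_within_K (L : language)
    (Gamma : (nat -> Prop) -> Prop) (P : nat -> Prop) : Prop :=
  within_K L Gamma P /\
  forall S, Gamma S ->
    exists f, [/\ computable_fun f, (forall n, index_set_K L (f n))
                & forall n, S n <-> P (f n)].

(* Main.v *)
Require Import Defs.
From mathcomp Require Import all_boot boolp.
Set Implicit Arguments. Unset Strict Implicit. Unset Printing Implicit Defensive.

(** Within K, a structure B is isomorphic to a structure A of size n exactly when
    B contains a copy of A (a c.e. condition on an index of B) and B does not
    have n + 1 distinct elements (a co-c.e. condition); for n = 0 the first
    condition only concerns the nullary relations and is decidable. That these
    conditions are c.e. uniformly in the index rests on a universal evaluator: a
    stack machine running the codes of partial recursive functions, whose
    one-step function is computable.

    For hardness, let P1 and P2 be c.e. with P2 contained in P1. The structure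
    attached to x starts with n - 1 elements labelled by elements of A; the last
    element of A is added when x enters P1 and one more element when x enters P2.
    An element records the stage at which it appears, so that the domain is
    decidable. For S = S1 - S2 take P1 = S1 and P2 = S1 /\ S2. *)

(** * Bijectivity of the pairing *)

Lemma npairS x y : (npair x y).+1 = 2 ^ x * (2 * y + 1).
Proof. by rewrite /npair prednK // muln_gt0 expn_gt0 addn1. Qed.

Lemma nfst_npair x y : nfst (npair x y) = x.
Proof.
rewrite /nfst npairS lognM ?expn_gt0 ?addn1 // pfactorK //.
by rewrite logn_coprime ?addn0 // coprime2n /= mul2n odd_double.
Qed.

Lemma nsnd_npair x y : nsnd (npair x y) = y.
Proof.
by rewrite /nsnd nfst_npair npairS mulKn ?expn_gt0 // addn1 mul2n /= doubleK.
Qed.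

(** Every positive number is a power of 2 times an odd number; for [z.+1] this gives surjectivity of
    the pairing. *)
Lemma npair_eta z : npair (nfst z) (nsnd z) = z.
Proof.
have [m odd_m ->] : exists2 m, odd m & z = (2 ^ nfst z * m).-1.
  exists (z.+1 %/ 2 ^ nfst z).
    have /(pfactor_coprime (isT : prime 2)) [m co_m Dz] : 0 < z.+1 by [].
    by rewrite /nfst {1}Dz mulnK ?expn_gt0 // -coprime2n.
  by rewrite mulnC divnK ?pfactor_dvdnn.
set x := nfst z; have ->: m = 2 * m./2 + 1.
  by rewrite mul2n addn1 -[LHS]odd_double_half odd_m.
by rewrite -/(npair _ _) nfst_npair nsnd_npair.
Qed.

(** The coding of lists thus iterates [npair], so lists and pickled data can be taken apart by
    predecessor, [cFst] and [cSnd]. *)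
Lemma code_cons x s : CodeSeq.code (x :: s) = (npair x (CodeSeq.code s)).+1.
Proof. by rewrite npairS /= mul2n addn1. Qed.

(** * Computable functions between encoded types *)

Class encoding (T : Type) := enc : T -> nat.

#[global] Instance encoding_nat : encoding nat := id.
#[global] Instance encoding_bool : encoding bool := nat_of_bool.
#[global] Instance encoding_prod S T {eS : encoding S} {eT : encoding T} :
  encoding (S * T) := fun p => npair (enc p.1) (enc p.2).
#[global] Instance encoding_seq T {eT : encoding T} : encoding (seq T) :=
  fun s => CodeSeq.code (map enc s).
#[global] Instance encoding_option T {eT : encoding T} : encoding (option T) :=
  fun o => if o is Some x then (enc x).+1 else 0.

Lemma enc_cons T {eT : encoding T} (x : T) s :
  enc (x :: s) = (npair (enc x) (enc s)).+1.
Proof. exact: code_cons. Qed.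

(** The code [c] may do anything on numbers outside the range of [enc]. *)
Definition computable {X Y : Type} {eX : encoding X} {eY : encoding Y}
    (f : X -> Y) : Prop :=
  exists c, forall x, peval c (enc x) (enc (f x)).

Section BasicClosure.
Context {X Y Z T : Type} {eX : encoding X} {eY : encoding Y} {eZ : encoding Z}
  {eT : encoding T}.

Lemma computable_ext (f g : X -> Y) : f =1 g -> computable f -> computable g.
Proof. by move=> fg [c cP]; exists c => x; rewrite -fg. Qed.

Lemma computable_comp (f : X -> Y) (g : Y -> Z) :
  computable g -> computable f -> computable (fun x => g (f x)).
Proof.
by move=> [c cP] [d dP]; exists (cComp c d) => x; apply: evComp (dP x) (cP _).
Qed.

(** Computability depends only on the codes of the values; operations on lists, options and programs
    are thereby reduced to arithmetic on codes. *)
Lemma computable_transfer (f : X -> Y) (g : X -> Z) :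
  (forall x, enc (f x) = enc (g x)) -> computable f -> computable g.
Proof. by move=> fg [c cP]; exists c => x; rewrite -fg. Qed.

Lemma computable_enc (f : X -> Y) :
  computable f -> computable (fun x => enc (f x)).
Proof. by case=> c cP; exists c. Qed.

(** The basis has no code for the identity; pairing the two projections gives it. *)
Lemma computable_id : computable (fun x : X => x).
Proof.
exists (cPair cFst cSnd) => x; rewrite -{2}[enc x]npair_eta.
by apply: evPair; [apply: evFst | apply: evSnd].
Qed.

Lemma computable_pair (f : X -> Y) (g : X -> Z) :
  computable f -> computable g -> computable (fun x => (f x, g x)).
Proof.
by move=> [c cP] [d dP]; exists (cPair c d) => x; apply: evPair (cP x) (dP x).
Qed.

Lemma computable_fst (f : X -> Y * Z) :
  computable f -> computable (fun x => (f x).1).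
Proof.
move=> [c cP]; exists (cComp cFst c) => x; apply: evComp (cP x) _.
by rewrite -(nfst_npair (enc (f x).1) (enc (f x).2)); apply: evFst.
Qed.

Lemma computable_snd (f : X -> Y * Z) :
  computable f -> computable (fun x => (f x).2).
Proof.
move=> [c cP]; exists (cComp cSnd c) => x; apply: evComp (cP x) _.
by rewrite -(nsnd_npair (enc (f x).1) (enc (f x).2)); apply: evSnd.
Qed.

Lemma computable_succ (f : X -> nat) :
  computable f -> computable (fun x => (f x).+1).
Proof.
by move=> [c cP]; exists (cComp cSucc c) => x; apply: evComp (cP x) (evSucc _).
Qed.

Lemma computable_nfst (f : X -> nat) :
  computable f -> computable (fun x => nfst (f x)).
Proof.
by move=> [c cP]; exists (cComp cFst c) => x; apply: evComp (cP x) (evFst _).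
Qed.

Lemma computable_nsnd (f : X -> nat) :
  computable f -> computable (fun x => nsnd (f x)).
Proof.
by move=> [c cP]; exists (cComp cSnd c) => x; apply: evComp (cP x) (evSnd _).
Qed.

Lemma computable_npair (f g : X -> nat) :
  computable f -> computable g -> computable (fun x => npair (f x) (g x)).
Proof.
by move=> [c cP] [d dP]; exists (cPair c d) => x; apply: evPair (cP x) (dP x).
Qed.

Lemma computable_cst (y : Y) : computable (fun _ : X => y).
Proof.
rewrite /computable; elim: (enc y) => [|n [c cP]].
  by exists cZero => x; apply: evZero.
by exists (cComp cSucc c) => x; apply: evComp (cP x) (evSucc n).
Qed.

(** The argument [(x, (m, t))] of [F] has the layout in which [cPrec] passes parameter, counter and
    previous value. *)
Lemma computable_nat_rect (z : X -> T) (F : X * (nat * T) -> T) (n : X -> nat) :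
  computable z -> computable F -> computable n ->
  computable (fun x => nat_rect (fun=> T) (z x) (fun m t => F (x, (m, t))) (n x)).
Proof.
move=> [cz czP] [cF cFP] [cn cnP]; have [ci ciP] := computable_id.
exists (cComp (cPrec cz cF) (cPair ci cn)) => x.
apply: evComp (evPair (ciP x) (cnP x)) _.
rewrite /enc /encoding_nat /id; elim: (n x) => [|m IHm]; first exact: evPrec0.
exact: evPrecS IHm (cFP (x, (m, _))).
Qed.

End BasicClosure.

Section ArithmeticClosure.
Context {X Y Z T : Type} {eX : encoding X} {eY : encoding Y} {eZ : encoding Z}
  {eT : encoding T}.

Lemma computable_iter (z : X -> T) (F : X * T -> T) (n : X -> nat) :
  computable z -> computable F -> computable n ->
  computable (fun x => iter (n x) (fun t => F (x, t)) (z x)).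
Proof.
move=> cz cF cn; pose G (p : X * (nat * T)) := F (p.1, p.2.2).
have cG : computable G.
  apply: (computable_comp cF); apply: computable_pair.
    by apply: computable_fst; apply: computable_id.
  by do 2!apply: computable_snd; apply: computable_id.
apply: computable_ext (computable_nat_rect cz cG cn) => x.
by elim: (n x) => //= m ->.
Qed.

Lemma computable_pred (f : X -> nat) :
  computable f -> computable (fun x => (f x).-1).
Proof.
move=> cf; pose G (p : X * (nat * nat)) := p.2.1.
have cG : computable G.
  by apply: computable_fst; apply: computable_snd; apply: computable_id.
apply: computable_ext (computable_nat_rect (computable_cst 0) cG cf) => x.
by case: (f x).
Qed.

(** A boolean is coded by 0 or 1, so a case distinction is a recursion of that length, starting at
    [g] and replacing the value by [f]. *)
Lemma computable_if (b : X -> bool) (f g : X -> Y) :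
  computable b -> computable f -> computable g ->
  computable (fun x => if b x then f x else g x).
Proof.
move=> cb cf cg; pose G (p : X * (nat * Y)) := f p.1.
have cG : computable G.
  by apply: (computable_comp cf); apply: computable_fst; apply: computable_id.
apply: computable_ext (computable_nat_rect cg cG (computable_enc cb)) => x.
by case: (b x).
Qed.

Lemma computable_eq0 (f : X -> nat) :
  computable f -> computable (fun x => f x == 0).
Proof.
move=> cf; pose G (p : X * (nat * bool)) := false.
have cG : computable G by apply: computable_cst.
apply: computable_ext (computable_nat_rect (computable_cst true) cG cf) => x.
by case: (f x).
Qed.

End ArithmeticClosure.

Section DataClosure.
Context {X Y Z T : Type} {eX : encoding X} {eY : encoding Y} {eZ : encoding Z}
  {eT : encoding T}.

Lemma computable_and (a b : X -> bool) :
  computable a -> computable b -> computable (fun x => a x && b x).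
Proof. by move=> ca cb; apply: computable_if => //; apply: computable_cst. Qed.

Lemma computable_or (a b : X -> bool) :
  computable a -> computable b -> computable (fun x => a x || b x).
Proof. by move=> ca cb; apply: computable_if => //; apply: computable_cst. Qed.

Lemma computable_not (a : X -> bool) :
  computable a -> computable (fun x => ~~ a x).
Proof. by move=> ca; apply: computable_if => //; apply: computable_cst. Qed.

Lemma computable_sub (f g : X -> nat) :
  computable f -> computable g -> computable (fun x => f x - g x).
Proof.
move=> cf cg; pose G (p : X * nat) := p.2.-1.
have cG : computable G.
  by apply: computable_pred; apply: computable_snd; apply: computable_id.
apply: computable_ext (computable_iter cf cG cg) => x.
by elim: (g x) => [|m IHm]; rewrite ?subn0 //= IHm /G subnS.
Qed.

Lemma computable_leq (f g : X -> nat) :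
  computable f -> computable g -> computable (fun x => f x <= g x).
Proof. by move=> cf cg; apply: computable_eq0; apply: computable_sub. Qed.

Lemma computable_eqn (f g : X -> nat) :
  computable f -> computable g -> computable (fun x => f x == g x).
Proof.
move=> cf cg; apply: computable_ext (fun x => (f x <= g x) && (g x <= f x)) _ _ _.
  by move=> x; rewrite eqn_leq.
by apply: computable_and; apply: computable_leq.
Qed.

Lemma computable_cons (f : X -> T) (g : X -> seq T) :
  computable f -> computable g -> computable (fun x => f x :: g x).
Proof.
move=> /computable_enc cf /computable_enc cg.
have := computable_succ (computable_npair cf cg).
by apply: computable_transfer => x; rewrite enc_cons.
Qed.

Lemma computable_behead (f : X -> seq T) :
  computable f -> computable (fun x => behead (f x)).
Proof.
(* The empty list has code 0, and [npair 0 0 = 0], so the same formula sends it to itself. *)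
move=> /computable_enc cf; have := computable_nsnd (computable_pred cf).
apply: computable_transfer => x; case: (f x) => [//|y s].
by rewrite enc_cons /enc /= nsnd_npair.
Qed.

Lemma computable_nilp (f : X -> seq T) :
  computable f -> computable (fun x => nilp (f x)).
Proof.
move=> /computable_enc /computable_eq0; apply: computable_ext => x.
by case: (f x) => // y s; rewrite enc_cons.
Qed.

Lemma computable_head (d : X -> T) (f : X -> seq T) :
  computable d -> computable f -> computable (fun x => head (d x) (f x)).
Proof.
move=> /computable_enc cd cf; have /computable_enc cf' := cf.
have := computable_if (computable_nilp cf) cd
          (computable_nfst (computable_pred cf')).
apply: computable_transfer => x; case: (f x) => [//|y s].
by rewrite enc_cons /enc /= nfst_npair.
Qed.

(** The index is a fixed number, so this is a fixed number of tails followed by a head. *)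
Lemma computable_nth (f : X -> seq T) (d : T) i :
  computable f -> computable (fun x => nth d (f x) i).
Proof.
elim: i f => [|i IHi] f cf.
  by apply: computable_ext (computable_head (computable_cst d) cf) => x; case: (f x).
apply: computable_ext (IHi _ (computable_behead cf)) => x.
by rewrite nth_behead.
Qed.

Lemma computable_some (f : X -> T) :
  computable f -> computable (fun x => Some (f x)).
Proof.
by move=> /computable_enc /computable_succ; apply: computable_transfer.
Qed.

Lemma computable_isSome (f : X -> option T) :
  computable f -> computable (fun x => isSome (f x)).
Proof.
move=> /computable_enc /computable_eq0 /computable_not; apply: computable_ext.
by move=> x; case: (f x).
Qed.

Lemma computable_odflt (d : X -> T) (f : X -> option T) :
  computable d -> computable f -> computable (fun x => odflt (d x) (f x)).
Proof.
move=> /computable_enc cd cf; have /computable_enc cf' := cf.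
have := computable_if (computable_isSome cf) (computable_pred cf') cd.
by apply: computable_transfer => x; case: (f x).
Qed.

(** A list of numbers is encoded by [CodeSeq.code] itself, so decoding is the identity on codes. *)
Lemma computable_decode (f : X -> nat) :
  computable f -> computable (fun x => CodeSeq.decode (f x)).
Proof.
apply: computable_transfer => x.
by rewrite {2}/enc /encoding_seq map_id CodeSeq.decodeK.
Qed.

Lemma computable_code (f : X -> seq nat) :
  computable f -> computable (fun x => CodeSeq.code (f x)).
Proof. by apply: computable_transfer => x; rewrite {1}/enc /encoding_seq map_id. Qed.

End DataClosure.

(** This lets the code of a list serve as a bound for the number of rounds of a loop over it. *)
Lemma size_leq_enc T {eT : encoding T} (s : seq T) : size s <= enc s.
Proof.
elim: s => //= x s IHs; rewrite enc_cons ltnS.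
apply: leq_trans IHs _; rewrite -ltnS npairS.
rewrite (leq_trans _ (leq_pmull _ _)) ?expn_gt0 // addn1 ltnS.
by rewrite mul2n -addnn leq_addr.
Qed.

Lemma computable_foldl {X Y T : Type} {eX : encoding X} {eY : encoding Y}
    {eT : encoding T} (dY : Y) (F : X * (T * Y) -> T) (z : X -> T)
    (l : X -> seq Y) :
  computable F -> computable z -> computable l ->
  computable (fun x => foldl (fun t y => F (x, (t, y))) (z x) (l x)).
Proof.
(* One round consumes the head of the list. On an empty list the state is left unchanged, so running
   [enc (l x)] rounds, possibly too many, is harmless. *)
move=> cF cz cl; pose G (p : X * (T * seq Y)) :=
  if nilp p.2.2 then p.2
  else (F (p.1, (p.2.1, head dY p.2.2)), behead p.2.2).
have cp : computable (fun p : X * (T * seq Y) => p) by apply: computable_id.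
have cG : computable G.
  have c2 := computable_snd cp; have cl2 := computable_snd c2.
  apply: computable_if => //; first exact: computable_nilp.
  apply: computable_pair; last exact: computable_behead.
  apply: (computable_comp cF); apply: computable_pair.
    exact: computable_fst.
  apply: computable_pair; first exact: computable_fst.
  by apply: computable_head => //; apply: computable_cst.
have := computable_fst (computable_iter (computable_pair cz cl) cG
                          (computable_enc cl)).
apply: computable_ext => x.
have le_l : size (l x) <= enc (l x) by apply: size_leq_enc.
move: le_l; move: (enc (l x)) (z x) => n t.
elim: n (l x) t => [|n IHn] s t le_n; first by case: s le_n.
rewrite iterSr; case: s le_n => [|y s] le_n; first exact: (IHn [::]).
exact: IHn.
Qed.

Lemma computable_rev {X Y : Type} {eX : encoding X} {eY : encoding Y} (dY : Y)
    (l : X -> seq Y) :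
  computable l -> computable (fun x => rev (l x)).
Proof.
move=> cl; pose F (p : X * (seq Y * Y)) := p.2.2 :: p.2.1.
have cF : computable F.
  by apply: computable_cons; [apply: computable_snd | apply: computable_fst];
     apply: computable_snd; apply: computable_id.
apply: computable_ext (computable_foldl dY cF (computable_cst [::]) cl) => x.
by rewrite /rev; elim: (l x) [::] => //=.
Qed.

Lemma computable_foldr {X Y T : Type} {eX : encoding X} {eY : encoding Y}
    {eT : encoding T} (dY : Y) (F : X * (T * Y) -> T) (z : X -> T)
    (l : X -> seq Y) :
  computable F -> computable z -> computable l ->
  computable (fun x => foldr (fun y t => F (x, (t, y))) (z x) (l x)).
Proof.
move=> cF cz cl.
apply: computable_ext (computable_foldl dY cF cz (computable_rev dY cl)) => x.
by rewrite foldl_rev.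
Qed.

(** * The abstract machine *)

(* [npair 0 0 = 0], so both subcodes of a leaf are [cZero]. *)
#[global] Instance encoding_pcode : encoding pcode :=
  fix num c := match c with
  | cZero => 0
  | cSucc => npair 1 0
  | cFst => npair 2 0
  | cSnd => npair 3 0
  | cPair f g => npair 4 (npair (num f) (num g))
  | cComp f g => npair 5 (npair (num f) (num g))
  | cPrec f g => npair 6 (npair (num f) (num g))
  | cMu f => npair 7 (npair (num f) 0)
  end.

Definition ptag (c : pcode) : nat :=
  match c with
  | cZero => 0 | cSucc => 1 | cFst => 2 | cSnd => 3
  | cPair _ _ => 4 | cComp _ _ => 5 | cPrec _ _ => 6 | cMu _ => 7
  end.

Definition psub1 (c : pcode) : pcode :=
  match c with
  | cPair f _ | cComp f _ | cPrec f _ | cMu f => f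
  | _ => cZero
  end.

Definition psub2 (c : pcode) : pcode :=
  match c with cPair _ g | cComp _ g | cPrec _ g => g | _ => cZero end.

(** All constructors share this shape, so the tag and the subcodes are obtained by projections. *)
Lemma enc_pcode c :
  enc c = npair (ptag c) (npair (enc (psub1 c)) (enc (psub2 c))).
Proof. by case: c. Qed.

Section PcodeClosure.
Context {X : Type} {eX : encoding X}.

Lemma computable_ptag (f : X -> pcode) :
  computable f -> computable (fun x => ptag (f x)).
Proof.
move=> /computable_enc /computable_nfst; apply: computable_ext => x.
by rewrite enc_pcode nfst_npair.
Qed.

Lemma computable_psub1 (f : X -> pcode) :
  computable f -> computable (fun x => psub1 (f x)).
Proof.
move=> /computable_enc /computable_nsnd /computable_nfst.
apply: computable_transfer => x.
by rewrite (enc_pcode (f x)) nsnd_npair nfst_npair.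
Qed.

Lemma computable_psub2 (f : X -> pcode) :
  computable f -> computable (fun x => psub2 (f x)).
Proof.
move=> /computable_enc /computable_nsnd /computable_nsnd.
apply: computable_transfer => x.
by rewrite (enc_pcode (f x)) !nsnd_npair.
Qed.

Lemma computable_pcode (f g h : X -> pcode) (t : nat) :
  (forall x, ptag (h x) = t) -> (forall x, psub1 (h x) = f x) ->
  (forall x, psub2 (h x) = g x) ->
  computable f -> computable g -> computable h.
Proof.
move=> ht hf hg /computable_enc cf /computable_enc cg.
have := computable_npair (computable_cst t) (computable_npair cf cg).
by apply: computable_transfer => x; rewrite (enc_pcode (h x)) ht hf hg.
Qed.

End PcodeClosure.

Ltac computability_step :=
  lazymatch goal with
  | |- computable (fun x => x) => exact: computable_id
  | |- computable (fun x => (_, _)) => apply: computable_pair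
  | |- computable (fun x => fst _) => apply: computable_fst
  | |- computable (fun x => snd _) => apply: computable_snd
  | |- computable (fun x => if _ then _ else _) => apply: computable_if
  | |- computable (fun x => nfst _) => apply: computable_nfst
  | |- computable (fun x => nsnd _) => apply: computable_nsnd
  | |- computable (fun x => npair _ _) => apply: computable_npair
  | |- computable (fun x => _ && _) => apply: computable_and
  | |- computable (fun x => _ || _) => apply: computable_or
  | |- computable (fun x => ~~ _) => apply: computable_not
  | |- computable (fun x => leq _ _) => apply: computable_leq
  | |- computable (fun x => eq_op _ _) => apply: computable_eqn
  | |- computable (fun x => _ :: _) => apply: computable_cons
  | |- computable (fun x => head _ _) => apply: computable_head
  | |- computable (fun x => behead _) => apply: computable_behead
  | |- computable (fun x => nilp _) => apply: computable_nilp
  | |- computable (fun x => nth _ _ _) => apply: computable_nth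
  | |- computable (fun x => Some _) => apply: computable_some
  | |- computable (fun x => odflt _ _) => apply: computable_odflt
  | |- computable (fun x => isSome _) => apply: computable_isSome
  | |- computable (fun x => CodeSeq.decode _) => apply: computable_decode
  | |- computable (fun x => CodeSeq.code _) => apply: computable_code
  | |- computable fst => exact: computable_fst computable_id
  | |- computable snd => exact: computable_snd computable_id
  | |- computable CodeSeq.decode => exact: computable_decode computable_id
  | |- computable (fun x => ptag _) => apply: computable_ptag
  | |- computable (fun x => psub1 _) => apply: computable_psub1
  | |- computable (fun x => psub2 _) => apply: computable_psub2
  | |- computable (fun x => predn _) => apply: computable_pred
  | |- computable (fun x => succn _) => apply: computable_succ
  end.

Ltac computability :=
  repeat first [exact: computable_cst | computability_step | by auto].

(* A frame is a kind, a code and two saved numbers [a], [b]; applied to the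
   current value [x], it stands for
     0: evaluate the code at [x];
     1: the right half of a pairing, [x] being the left result, at input [a];
     2: pair [a] with [x];
     3: the recursion step number [b] with parameter [a];
     4: minimisation at parameter [a], [x] being the value at [b]. *)
Definition frame : Type := (nat * pcode) * (nat * nat).

Definition run_frame (c : pcode) : frame := (0, c, (0, 0)).

Definition eval_step (q : pcode * (seq frame * nat)) : seq frame * nat :=
  if ptag q.1 == 0 then (q.2.1, 0)
  else if ptag q.1 == 1 then (q.2.1, q.2.2.+1)
  else if ptag q.1 == 2 then (q.2.1, nfst q.2.2)
  else if ptag q.1 == 3 then (q.2.1, nsnd q.2.2)
  else if ptag q.1 == 4 then
    (((0, psub1 q.1), (0, 0)) :: ((1, psub2 q.1), (q.2.2, 0)) :: q.2.1, q.2.2)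
  else if ptag q.1 == 5 then
    (((0, psub2 q.1), (0, 0)) :: ((0, psub1 q.1), (0, 0)) :: q.2.1, q.2.2)
  else if ptag q.1 == 6 then
    if nsnd q.2.2 == 0 then (((0, psub1 q.1), (0, 0)) :: q.2.1, nfst q.2.2)
    else (((0, q.1), (0, 0)) ::
          ((3, psub2 q.1), (nfst q.2.2, (nsnd q.2.2).-1)) :: q.2.1,
          npair (nfst q.2.2) (nsnd q.2.2).-1)
  else (((0, psub1 q.1), (0, 0)) :: ((4, psub1 q.1), (q.2.2, 0)) :: q.2.1,
        npair q.2.2 0).

Definition frame_step (q : frame * (seq frame * nat)) : seq frame * nat :=
  if q.1.1.1 == 0 then eval_step (q.1.1.2, q.2)
  else if q.1.1.1 == 1 then
    (((0, q.1.1.2), (0, 0)) :: ((2, cZero), (q.2.2, 0)) :: q.2.1, q.1.2.1)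
  else if q.1.1.1 == 2 then (q.2.1, npair q.1.2.1 q.2.2)
  else if q.1.1.1 == 3 then
    (((0, q.1.1.2), (0, 0)) :: q.2.1, npair q.1.2.1 (npair q.1.2.2 q.2.2))
  else if q.2.2 == 0 then (q.2.1, q.1.2.2)
  else (((0, q.1.1.2), (0, 0)) ::
        ((4, q.1.1.2), (q.1.2.1, q.1.2.2.+1)) :: q.2.1,
        npair q.1.2.1 q.1.2.2.+1).

Definition step (p : seq frame * nat) : seq frame * nat :=
  if nilp p.1 then p
  else frame_step (head (run_frame cZero) p.1, (behead p.1, p.2)).

Lemma computable_eval_step : computable eval_step.
Proof.
by rewrite /eval_step; computability.
Qed.

Lemma computable_step : computable step.
Proof.
have c_frame : computable frame_step.
  rewrite /frame_step; computability.
  apply: (computable_comp computable_eval_step); computability.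
by rewrite /step; computability; apply: (computable_comp c_frame); computability.
Qed.

(** The big-step meaning of a frame turning [x] into [y]. In the last kind a positive [x] means that
    the value at [b] has been rejected, so [y] is the first zero strictly beyond [b]. *)
Definition frame_rel (fr : frame) (x y : nat) : Prop :=
  let: (t, c, (a, b)) := fr in
  match t with
  | 0 => peval c x y
  | 1 => exists2 z, peval c a z & y = npair x z
  | 2 => y = npair a x
  | 3 => peval c (npair a (npair b x)) y
  | _ => if x is 0 then y = b else
         [/\ b < y, peval c (npair a y) 0
           & forall m, b < m < y -> exists k, peval c (npair a m) k.+1]
  end.

Fixpoint stack_rel (k : seq frame) (x z : nat) : Prop :=
  if k is fr :: k' then exists2 y, frame_rel fr x y & stack_rel k' y z
  else x = z.

(** Soundness of the machine, read backwards: each constructor of [peval] reassembles the derivation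
    that one step has split into frames. *)
Lemma stack_rel_step p z :
  stack_rel (step p).1 (step p).2 z -> stack_rel p.1 p.2 z.
Proof.
case: p => [[|[[t c] [a b]] k] x] //.
rewrite /step /=; case: t => [|[|[|[|t]]]] /=.
- case: c => [||||f g|f g|f g|f] /=.
  + by exists 0 => //; apply: evZero.
  + by exists x.+1 => //; apply: evSucc.
  + by exists (nfst x) => //; apply: evFst.
  + by exists (nsnd x) => //; apply: evSnd.
  + by case=> u fu [_ [v gv ->] kz]; exists (npair u v) => //; apply: evPair.
  + by case=> u gu [v fv kz]; exists v => //; apply: evComp gu fv.
  + rewrite /frame_step /eval_step /=; case Dn: (nsnd x) => [|n] /= [u fu].
      by exists u => //; rewrite -[x]npair_eta Dn; apply: evPrec0.
    by case=> v gv kz; exists v => //; rewrite -[x]npair_eta Dn; apply: evPrecS fu gv.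
  + case=> -[|u] fu [v /= fv kz]; exists v => //.
      by rewrite fv; apply: evMu.
    case: fv => v0 fv lt_v; apply: evMu fv _ => -[|m] lt_m; first by exists u.
    exact: lt_v.
- by case=> u fu [_ -> kz]; exists (npair x u) => //; exists u.
- by move=> kz; exists (npair a x).
- by [].
- rewrite /frame_step; case: x => [|x] /=; first by exists b.
  case=> -[|u] fu [v /= fv kz]; exists v => //.
    by rewrite fv; split=> // m /andP[lt_bm]; rewrite ltnS leqNgt lt_bm.
  case: fv => lt_v fv lt_m; split=> //; first exact: ltnW.
  move=> m /andP[]; rewrite leq_eqVlt => /predU1P[<- _|lt_bm lt_mv].
    by exists u.
  by apply: lt_m; rewrite lt_bm.
Qed.

Lemma stack_rel_iter s p z :
  stack_rel (iter s step p).1 (iter s step p).2 z -> stack_rel p.1 p.2 z.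
Proof. by elim: s => //= s IHs /stack_rel_step. Qed.

(** The rest [k] of the stack is arbitrary, so that runs of subcodes can be placed above the frames
    waiting for their results. *)
Lemma peval_run c x y :
  peval c x y -> forall k, exists s, iter s step (run_frame c :: k, x) = (k, y).
Proof.
(* Recursion on the derivation itself: the generated induction principle gives no hypothesis for the
   derivations under the existential in [evMu]. *)
move: c x y; fix IH 4 => c x y [] {c x y}.
- by move=> x k; exists 1.
- by move=> x k; exists 1.
- by move=> x k; exists 1.
- by move=> x k; exists 1.
- move=> f g x a b /IH IHf /IH IHg k.
  have [s fs] := IHf (((1, g), (x, 0)) :: k).
  have [t gt] := IHg (((2, cZero), (a, 0)) :: k).
  exists (1 + (t + (1 + (s + 1)))).
  by rewrite !iterD /= /step /= fs /= gt.
- move=> f g x y z /IH IHg /IH IHf k.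
  have [s gs] := IHg (run_frame f :: k); have [t ft] := IHf k.
  by exists (t + (s + 1)); rewrite !iterD /= /step /= gs ft.
- move=> f g x y /IH IHf k; have [s fs] := IHf k; exists (s + 1).
  by rewrite iterD /= /step /= /frame_step /eval_step /= nsnd_npair nfst_npair.
- move=> f g x n y z /IH IHf /IH IHg k.
  have [s fs] := IHf (((3, g), (x, n)) :: k); have [t gt] := IHg k.
  have st : step (run_frame (cPrec f g) :: k, npair x n.+1)
      = (run_frame (cPrec f g) :: ((3, g), (x, n)) :: k, npair x n).
    by rewrite /step /frame_step /eval_step /= nsnd_npair nfst_npair.
  by exists (t + (1 + s.+1)); rewrite !iterD (iterSr s) st fs.
- move=> f x n /IH IHf f_lt k.
  have {}f_lt m : m < n -> exists u, forall k, exists s,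
      iter s step (run_frame f :: k, npair x m) = (k, u.+1).
    by case/f_lt => u /IH; exists u.
  suffices [s fs] : exists s, iter s step
      (run_frame f :: ((4, f), (x, 0)) :: k, npair x 0) = (k, n).
    by exists (s + 1); rewrite iterD.
  (* The search is followed from any candidate [b], by induction on its distance [d] to the least
     zero [n]. *)
  suffices loop d : forall b, b <= n -> n - b = d ->
      exists s, iter s step
        (run_frame f :: ((4, f), (x, b)) :: k, npair x b) = (k, n).
    by apply: (loop n 0) => //; rewrite subn0.
  elim: d => [|d IHd] b le_b Dd.
    have -> : b = n by apply/eqP; rewrite eqn_leq le_b -subn_eq0 Dd.
    have [s fs] := IHf (((4, f), (x, n)) :: k).
    by exists (1 + s); rewrite iterD fs.
  have lt_b : b < n by rewrite -subn_gt0 Dd.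
  have [u /(_ (((4, f), (x, b)) :: k)) [s fs]] := f_lt b lt_b.
  have [|t ft] := IHd b.+1 lt_b; first by rewrite subnS Dd.
  by exists (t + (1 + s)); rewrite !iterD fs.
Qed.

Lemma peval_iter_step c x y :
  peval c x y <-> exists s, iter s step ([:: run_frame c], x) = ([::], y).
Proof.
split=> [/peval_run|[s run_s]]; first exact.
suffices /(stack_rel_iter (s := s)) [z /= cz <-] :
    stack_rel (iter s step ([:: run_frame c], x)).1
              (iter s step ([:: run_frame c], x)).2 y by [].
by rewrite run_s.
Qed.

(** A configuration with empty stack is stationary, so two halting runs agree after the sum of their
    lengths. *)
Lemma peval_det c x y z : peval c x y -> peval c x z -> y = z.
Proof.
move=> /peval_iter_step[s sy] /peval_iter_step[t tz].
have stop m v : iter m step ([::], v) = ([::], v) by elim: m => //= m ->.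
have := congr1 (iter t step) sy; have := congr1 (iter s step) tz.
by rewrite -!iterD addnC !stop => -> [].
Qed.

Lemma phi_det a x y z : phi a x y -> phi a x z -> y = z.
Proof. exact: peval_det. Qed.

(** * Decoding indices *)

(** This is [pcode_dec] at a single node whose children are already decoded; it allows the recursion
    on trees to be replaced by a loop with a stack. *)
Definition pcode_node (n : nat) (l : seq (option pcode)) : option pcode :=
  if nilp l then
    if n == 0 then Some cZero else if n == 1 then Some cSucc
    else if n == 2 then Some cFst else if n == 3 then Some cSnd else None
  else if ~~ isSome (head None l) then None
  else if nilp (behead l) then
    if n == 7 then Some (cMu (odflt cZero (head None l))) else None
  else if ~~ nilp (behead (behead l)) || ~~ isSome (head None (behead l)) then None
  else if n == 4 then
    Some (cPair (odflt cZero (head None l)) (odflt cZero (head None (behead l))))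
  else if n == 5 then
    Some (cComp (odflt cZero (head None l)) (odflt cZero (head None (behead l))))
  else if n == 6 then
    Some (cPrec (odflt cZero (head None l)) (odflt cZero (head None (behead l))))
  else None.

Lemma pcode_dec_node n ts :
  pcode_dec (GenTree.Node n ts) = pcode_node n (map pcode_dec ts).
Proof.
case: n => [|[|[|[|[|[|[|[|n]]]]]]]]; case: ts => [|t1 [|t2 [|t3 ts]]] //=;
  rewrite /pcode_node /=; case: (pcode_dec t1) => [f|] //=;
  by case: (pcode_dec t2) => [g|].
Qed.

Definition forest : Type := seq (option pcode) * seq (seq (option pcode)).

(* One step of [GenTree.decode], on a pickled token [m] of type [nat + nat] and
   with trees replaced by the codes they denote. *)
Definition token_step (m : nat) (fs : forest) : forest :=
  let l := CodeSeq.decode m in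
  if nilp (behead l) || ~~ nilp (behead (behead l)) then fs
  else if ~~ nilp (CodeSeq.decode (nth 0 l 1)) then (None :: fs.1, fs.2)
  else if nilp (CodeSeq.decode (nth 0 l 0)) then fs
  else if nth 0 (CodeSeq.decode (nth 0 l 0)) 0 == 0 then ([::], fs.1 :: fs.2)
  else (pcode_node (nth 0 (CodeSeq.decode (nth 0 l 0)) 0).-1 fs.1
          :: head [::] fs.2, behead fs.2).

Definition index_code (a : nat) : pcode :=
  odflt cZero
    (head None (foldr token_step ([::], [::]) (CodeSeq.decode a)).1).

Definition dec_forest (fs : seq (GenTree.tree nat) * seq (seq (GenTree.tree nat)))
  : forest := (map pcode_dec fs.1, map (map pcode_dec) fs.2).

(** A sum is pickled through a tagged pair of options, and an option as a list of length at most
    one. A token is thus a list of two such lists, the second taking precedence. *)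
Lemma unpickle_token (m : nat) :
  unpickle m = (if CodeSeq.decode m is [:: x; y] then
    sum_of_opair (ohead (CodeSeq.decode x), ohead (CodeSeq.decode y))
  else None) :> option (nat + nat).
Proof.
have unpickle_opt k :
    unpickle k = Some (ohead (CodeSeq.decode k)) :> option (option nat).
  rewrite /unpickle /= /pcomp /= /unpickle_seq /=.
  by congr (Some (ohead _)); elim: (CodeSeq.decode k) => //= x s ->.
have -> : unpickle m = obind (sum_of_opair (T1:=nat) (T2:=nat) \o pair_of_tag)
    (unpickle m : option {_ : option nat & option nat}).
  rewrite {1}/unpickle /= /pcomp /= {1}/unpickle /= /pcomp /=.
  by case: (unpickle m).
rewrite {1}/unpickle /= /unpickle_tagged.
case: (CodeSeq.decode m) => [|x [|y [|z s]]] //.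
by rewrite !unpickle_opt.
Qed.

Lemma unpickle_pcode a :
  unpickle a = obind pcode_dec
    (GenTree.decode (pmap unpickle (CodeSeq.decode a))) :> option pcode.
Proof. by []. Qed.

(** Simulation of the tree decoder: replacing trees by the codes they denote commutes with each
    step, and unreadable tokens are skipped on both sides. *)
Lemma token_stepE m fs :
  token_step m (dec_forest fs) =
  dec_forest (oapp (fun t => GenTree.decode_step t fs) fs (unpickle m)).
Proof.
rewrite unpickle_token /token_step.
case: (CodeSeq.decode m) => [|x [|y [|z s]]] //=.
case: (CodeSeq.decode y) => [|v s] //=.
case: (CodeSeq.decode x) => [|[|u] s] //=.
rewrite /dec_forest /= -pcode_dec_node.
by case: fs.2.
Qed.

Lemma index_codeE a : index_code a = odflt cZero (unpickle a).
Proof.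
rewrite /index_code unpickle_pcode /GenTree.decode.
suffices -> : foldr token_step ([::], [::]) (CodeSeq.decode a) =
    dec_forest (foldr (@GenTree.decode_step nat) ([::], [::])
                  (pmap unpickle (CodeSeq.decode a))).
  by case: (foldr _ _ (pmap _ _)) => [[|t ts] us].
elim: (CodeSeq.decode a) => //= m s ->; rewrite token_stepE.
by case: (unpickle m).
Qed.

Lemma computable_index_code : computable index_code.
Proof.
pose G (p : nat * (forest * nat)) := token_step p.2.2 p.2.1.
have cG : computable G.
  rewrite /G /token_step; computability.
  rewrite /pcode_node; computability.
  - apply: (@computable_pcode _ _ (fun p => odflt cZero (head None p.2.1.1))
      (fun=> cZero) _ 7); computability.
  - apply: (@computable_pcode _ _ (fun p => odflt cZero (head None p.2.1.1))
      (fun p => odflt cZero (head None (behead p.2.1.1))) _ 4); computability.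
  - apply: (@computable_pcode _ _ (fun p => odflt cZero (head None p.2.1.1))
      (fun p => odflt cZero (head None (behead p.2.1.1))) _ 5); computability.
  - apply: (@computable_pcode _ _ (fun p => odflt cZero (head None p.2.1.1))
      (fun p => odflt cZero (head None (behead p.2.1.1))) _ 6); computability.
rewrite /index_code; computability.
apply: (computable_foldr 0 (F := G)); computability.
Qed.

(** * Semidecidable predicates *)

Definition semidecidable {X : Type} {eX : encoding X} (P : X -> Prop) : Prop :=
  exists2 f : X * nat -> bool, computable f & forall x, P x <-> exists s, f (x, s).

Section SemiClosure.
Context {X : Type} {eX : encoding X}.
Implicit Types P Q : X -> Prop.

Lemma semidecidable_ext P Q :
  (forall x, P x <-> Q x) -> semidecidable P -> semidecidable Q.
Proof. by move=> PQ [f cf fP]; exists f => // x; rewrite -PQ. Qed.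

Lemma semidecidable_comp {Y : Type} {eY : encoding Y} (P : X -> Prop)
    (g : Y -> X) :
  computable g -> semidecidable P -> semidecidable (fun y => P (g y)).
Proof.
move=> cg [f cf fP]; exists (fun p => f (g p.1, p.2)) => [|y //].
apply: (computable_comp cf); computability.
by apply: (computable_comp cg); computability.
Qed.

Lemma semidecidable_computable (b : X -> bool) :
  computable b -> semidecidable b.
Proof.
move=> cb; exists (fun p => b p.1) => [|x].
  by apply: (computable_comp cb); computability.
by split=> [bx|[s]] //; exists 0.
Qed.

Lemma semidecidable_and P Q :
  semidecidable P -> semidecidable Q -> semidecidable (fun x => P x /\ Q x).
Proof.
move=> [f cf fP] [g cg gP].
(* One number codes a stage for each conjunct. *)
exists (fun p => f (p.1, nfst p.2) && g (p.1, nsnd p.2)) => [|x].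
  computability; first by apply: (computable_comp cf); computability.
  by apply: (computable_comp cg); computability.
rewrite fP gP; split=> [[[s fs] [t gt]]|[s /andP[fs gs]]] /=.
  by exists (npair s t); rewrite nfst_npair nsnd_npair fs gt.
by split; [exists (nfst s) | exists (nsnd s)].
Qed.

Lemma semidecidable_or P Q :
  semidecidable P -> semidecidable Q -> semidecidable (fun x => P x \/ Q x).
Proof.
move=> [f cf fP] [g cg gP]; exists (fun p => f p || g p) => [|x].
  exact: computable_or.
rewrite fP gP; split=> [[[s fs]|[s gs]]|[s /orP[fs|gs]]].
- by exists s; rewrite fs.
- by exists s; rewrite gs orbT.
- by left; exists s.
by right; exists s.
Qed.

(** Dovetailing: one number codes both a candidate witness and a stage at which it is confirmed. *)
Lemma semidecidable_exists (P : X * nat -> Prop) :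
  semidecidable P -> semidecidable (fun x => exists n, P (x, n)).
Proof.
move=> [f cf fP]; exists (fun p => f ((p.1, nfst p.2), nsnd p.2)) => [|x].
  by apply: (computable_comp cf); computability.
split=> [[n /fP[s fs]]|[s fs]].
  by exists (npair n s); rewrite nfst_npair nsnd_npair.
by exists (nfst s); apply/fP; exists (nsnd s).
Qed.

Lemma semidecidable_all (I : eqType) (r : seq I) (P : I -> X -> Prop) :
  (forall i, i \in r -> semidecidable (P i)) ->
  semidecidable (fun x => forall i, i \in r -> P i x).
Proof.
elim: r => [|i r IHr] sP.
  by apply: semidecidable_ext (semidecidable_computable (computable_cst true)).
have sPi := sP i (mem_head i r).
have {IHr} sPr : semidecidable (fun x => forall j, j \in r -> P j x).
  by apply: IHr => j rj; apply: sP; rewrite inE rj orbT.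
apply: semidecidable_ext (semidecidable_and sPi sPr) => x.
split=> [[Pi Pr] j|Px]; first by rewrite inE => /predU1P[->|/Pr].
by split=> [|j rj]; apply: Px; rewrite inE ?eqxx ?rj ?orbT.
Qed.

Lemma semidecidable_has (I : eqType) (r : seq I) (P : I -> X -> Prop) :
  (forall i, i \in r -> semidecidable (P i)) ->
  semidecidable (fun x => exists2 i, i \in r & P i x).
Proof.
elim: r => [|i r IHr] sP.
  apply: semidecidable_ext (semidecidable_computable (computable_cst false)).
  by move=> x; split=> // -[].
have sPi := sP i (mem_head i r).
have {IHr} sPr : semidecidable (fun x => exists2 j, j \in r & P j x).
  by apply: IHr => j rj; apply: sP; rewrite inE rj orbT.
apply: semidecidable_ext (semidecidable_or sPi sPr) => x.
split=> [[Pi|[j rj Pj]]|[j]]; first by exists i; rewrite ?mem_head.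
  by exists j; rewrite // inE rj orbT.
by rewrite inE => /predU1P[->|rj] Pj; [left | right; exists j].
Qed.

(* Searching for the first stage makes the witness unique. *)
Lemma semidecidable_unique P :
  semidecidable P -> exists f : X * nat -> bool,
    [/\ computable f, forall x, P x <-> exists s, f (x, s)
      & forall x s t, f (x, s) -> f (x, t) -> s = t].
Proof.
move=> [f cf fP].
pose G (q : (X * nat) * (nat * bool)) := (q.2.1.+1, q.2.2 || f (q.1.1, q.2.1)).
pose before (p : X * nat) := (iter p.2 (fun t => G (p, t)) (0, false)).2.
have beforeP x t : before (x, t) = has (fun s => f (x, s)) (iota 0 t).
  rewrite /before; suffices -> : iter t (fun u => G ((x, t), u)) (0, false)
      = (t, has (fun s => f (x, s)) (iota 0 t)) by [].
  (* The parameter is frozen as [p], since only the number of iterations should vary in the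
     induction. *)
  move: (x, t) (erefl : (x, t).1 = x) => p Dx.
  elim: t => // n; rewrite iterS => ->.
  by rewrite -[in RHS]addn1 iotaD has_cat /G /= orbF Dx addn1.
have cG : computable G.
  by rewrite /G; computability; apply: (computable_comp cf); computability.
have cbefore : computable before.
  by apply: computable_snd; apply: computable_iter; computability.
exists (fun p => f p && ~~ before p); split.
- by computability.
- move=> x; rewrite fP; split=> [ex_s|[s /andP[fs _]]]; last by exists s.
  case: (ex_minnP ex_s) => s fs min_s; exists s; rewrite fs beforeP /=.
  apply/hasPn => t; rewrite mem_iota add0n /= => lt_ts.
  by apply: contraL lt_ts => /min_s; rewrite -leqNgt.
- move=> x s t /andP[fs ns] /andP[ft nt].
  have first_stage u v : f (x, u) -> ~~ before (x, v) -> v <= u.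
    rewrite beforeP leqNgt => fu /hasPn nv; apply/negP => lt_uv.
    by have := nv u; rewrite mem_iota add0n lt_uv fu => /(_ isT).
  by apply/eqP; rewrite eqn_leq !first_stage.
Qed.

End SemiClosure.

(** The stage is a number of machine steps, the machine being started on the program decoded from
    the index. *)
Lemma semidecidable_phi :
  semidecidable (fun p : nat * (nat * nat) => phi p.1 p.2.1 p.2.2).
Proof.
pose G (q : (nat * (nat * nat)) * nat * (seq frame * nat)) := step q.2.
pose run (q : (nat * (nat * nat)) * nat) :=
  iter q.2 (fun t => G (q, t)) ([:: run_frame (index_code q.1.1)], q.1.2.1).
have crun : computable run.
  apply: computable_iter; last by computability.
    rewrite /run_frame; computability.
    by apply: (computable_comp computable_index_code); computability.
  by apply: (computable_comp computable_step); computability.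
exists (fun q => nilp (run q).1 && ((run q).2 == q.1.2.2)) => [|[a [x y]]].
  by computability; exact: crun.
rewrite /phi -index_codeE peval_iter_step; split=> -[s].
  by move=> run_s; exists s; rewrite /run /G /= run_s /= eqxx.
rewrite /run /G /= => /andP[/nilP Dk /eqP Dy]; exists s.
by case: (iter _ _ _) Dk Dy => [k v] /= -> ->.
Qed.

Lemma ce_semidecidable (S : nat -> Prop) : ce S <-> semidecidable S.
Proof.
split=> [[a Sa]|[f [c cP] fP]].
  have /semidecidable_exists : semidecidable (fun p : nat * nat =>
      phi a p.1 p.2).
    have := @semidecidable_comp _ _ (nat * nat) _ _
      (fun p => (a, (p.1, p.2))) _ semidecidable_phi.
    by apply; computability.
  by apply: semidecidable_ext => x; rewrite Sa.
(* Minimisation looks for the value 0, hence the negation. *)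
have [d dP] : computable (fun p : nat * nat => ~~ f p).
  by apply: computable_not; exists c.
exists (pickle (cMu d)) => x; rewrite /halts /phi pickleK /= fP.
have dP' s : peval d (npair x s) (~~ f (x, s)) by exact: (dP (x, s)).
split=> [ex_s|[s]].
  case: (ex_minnP ex_s) => s fs min_s; exists s; apply: evMu.
    by have := dP' s; rewrite fs.
  (* Before the first successful stage the negation has value 1, the successor of the witness 0. *)
  move=> m lt_ms; exists 0; have := dP' m.
  by case fm: (f (x, m)) => //; have := min_s m fm; rewrite leqNgt lt_ms.
move=> ev_s; exists s; have := dP' s.
inversion ev_s as [| | | | | | | |? ? ? ev0]; subst.
by move=> /(peval_det ev0); case: (f _).
Qed.

Section ListClosure.
Context {X T : Type} {eX : encoding X} {eT : encoding T}.

Lemma computable_cat_cst (s : seq T) (f : X -> seq T) :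
  computable f -> computable (fun x => s ++ f x).
Proof. by move=> cf; elim: s => //= y s IHs; computability. Qed.

Lemma computable_has_cst (I : Type) (r : seq I) (b : I -> X -> bool) :
  (forall i, computable (b i)) -> computable (fun x => has (b^~ x) r).
Proof. by move=> cb; elim: r => [|i r IHr] /=; computability. Qed.

Lemma computable_all_cst (I : Type) (r : seq I) (b : I -> X -> bool) :
  (forall i, computable (b i)) -> computable (fun x => all (b^~ x) r).
Proof. by move=> cb; elim: r => [|i r IHr] /=; computability. Qed.

Lemma computable_map_cst (I : Type) (r : seq I) (f : I -> X -> T) :
  (forall i, computable (f i)) -> computable (fun x => [seq f i x | i <- r]).
Proof. by move=> cf; elim: r => [|i r IHr] /=; computability. Qed.

End ListClosure.

(** * Parametrisation *)

Fixpoint cst_code (n : nat) : pcode :=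
  if n is m.+1 then cComp cSucc (cst_code m) else cZero.

Lemma peval_cst_code n x : peval (cst_code n) x n.
Proof.
elim: n => [|n IHn] /=; first exact: evZero.
by apply: evComp IHn _; apply: evSucc.
Qed.

(** The s-m-n construction; [cPair cFst cSnd] computes the identity on the remaining argument. *)
Definition specialize (c : pcode) (x : nat) : pcode :=
  cComp c (cPair (cst_code x) (cPair cFst cSnd)).

Lemma peval_specialize c x m y :
  peval c (npair x m) y -> peval (specialize c x) m y.
Proof.
apply: evComp; apply: evPair (peval_cst_code x m) _.
rewrite -{2}[m]npair_eta; apply: evPair; [exact: evFst | exact: evSnd].
Qed.

(* The token encoding [pk] is kept abstract: pickled tokens are unary numbers as
   large as [2 ^ 2 ^ 6], which conversion must not evaluate. *)
Lemma computable_specialize_code (pk : nat + nat -> nat) c :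
  computable (fun x =>
    CodeSeq.code (map pk (GenTree.encode (pcode_enc (specialize c x))))).
Proof.
pose toks (d : pcode) : seq nat := map pk (GenTree.encode (pcode_enc d)).
pose wrap (p : nat * seq nat) := [:: pk (inl 6), pk (inl 2), pk (inl 0) & p.2].
pose close (p : nat * seq nat) := pk (inl 0) :: p.2.
(* The tokens of [cst_code x]: [x] times the opening of a composition followed by the successor,
   then the code of zero, then [x] closing brackets. Two loops produce them. *)
pose g (x : nat) (s : seq nat) := iter x (fun t => wrap (x, t))
  [:: pk (inl 1), pk (inl 0) & iter x (fun t => close (x, t)) s].
have gP x s : toks (cst_code x) ++ s = g x s.
  rewrite /g /wrap /close /=; elim: x s => // x IHx s.
  rewrite iterS (iterSr x (fun t => pk (inl 0) :: t)) -IHx.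
  by rewrite /toks /= cats0 map_rcons cat_rcons.
pose s := toks (cPair cFst cSnd) ++ [:: pk (inl 0); pk (inl 0)].
have specE x : toks (specialize c x) =
    (pk (inl 6) :: rcons (toks c) (pk (inl 5))) ++ g x s.
  rewrite -gP /s /toks /= !cats0 map_rcons map_cat /=.
  by rewrite !map_rcons map_cat /= -!cats1 /= -!catA /= -!catA.
apply: (computable_code (f := fun x => toks (specialize c x))).
apply: computable_ext (fun x => esym (specE x)) _.
apply: computable_cat_cst.
apply: computable_iter;
  [computability | by rewrite /wrap; computability | computability].
by apply: computable_iter; rewrite /close; computability.
Qed.

Lemma computable_specialize c : computable (fun x => pickle (specialize c x)).
Proof. exact: (computable_specialize_code pickle). Qed.

(** * Indices of structures *)

Section Structures.
Variable L : language.
Implicit Types A B C : structure L.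

Lemma pickle_AEq x y :
  pickle (AEq x y) = CodeSeq.code [:: CodeSeq.code [:: CodeSeq.code [:: x; y]]; 0].
Proof. by []. Qed.

Lemma pickle_ARel i xs : pickle (ARel i xs) =
  CodeSeq.code [:: 0; CodeSeq.code [:: CodeSeq.code [:: i; CodeSeq.code xs]]].
Proof. by rewrite -{2}[xs]map_id. Qed.

Lemma diagram_pickle A u : diagram A (pickle u) <-> holds A u.
Proof.
by split=> [[v [/(pcan_inj pickleK) ->]]|Au] //; exists u.
Qed.

Lemma is_index_phi a B u (b : bool) :
  is_index a B -> (phi a (pickle u) b <-> (b <-> holds B u)).
Proof.
move=> /(_ (pickle u)); rewrite diagram_pickle => -[phi1 phi0].
have [/[dup] Bu /phi1 ph|/[dup] Bu /phi0 ph] := pselect (holds B u).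
  split=> [/(phi_det ph)|bP]; first by case: b.
  by have -> : b by apply/bP.
split=> [/(phi_det ph)|bP]; first by case: b.
by case: b bP => // -[/(_ isT)].
Qed.

Lemma is_index_phi1 a B u : is_index a B -> (phi a (pickle u) 1 <-> holds B u).
Proof.
by move=> /(is_index_phi u true) ->; split=> [[/(_ isT)]|].
Qed.

Lemma holds_AEq B x : holds B (AEq x x) <-> sdom B x.
Proof. by split=> [[]|]. Qed.

(** Structures with the same index have the same diagram, so they agree on their domains and on the
    relations between elements; one map serves both. *)
Lemma is_index_iso a A B C :
  is_index a B -> is_index a C -> iso B A -> iso C A.
Proof.
move=> aB aC [f [f_dom [f_inj [f_surj f_rel]]]].
have BC u : holds B u <-> holds C u.
  by rewrite -(is_index_phi1 u aB) (is_index_phi1 u aC).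
have dBC x : sdom B x <-> sdom C x by rewrite -!holds_AEq BC.
exists f; split=> [x /dBC /f_dom //|]; split=> [x y /dBC Bx /dBC|].
  exact: f_inj.
split=> [y /f_surj[x /dBC]|i xs lt_i sz_xs Cxs]; first by exists x.
have Bxs x : x \in xs -> sdom B x by move=> /Cxs /dBC.
rewrite -f_rel //; have [/= BC1 BC2] := BC (ARel i xs).
by split=> [Ci|Bi]; [case: BC2 | case: BC1] => // _ [_ []].
Qed.

Lemma index_set_iso a A B : is_index a B -> (index_set A a <-> iso B A).
Proof.
move=> aB; split=> [[C [aC CA]]|BA]; first exact: is_index_iso aC aB CA.
by exists B.
Qed.

(** * Isomorphisms of finite structures through enumerations *)

Definition enumerates (s : seq nat) A : Prop :=
  uniq s /\ forall x, sdom A x <-> x \in s.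

Fixpoint tuples (n k : nat) : seq (seq nat) :=
  if k is k'.+1 then [seq i :: t | i <- iota 0 n, t <- tuples n k']
  else [:: [::]].

Lemma mem_tuples n k t : (t \in tuples n k) = (size t == k) && all (gtn n) t.
Proof.
elim: k t => [|k IHk] [|i t] //=; first by apply/allpairsP => -[[j u] []].
rewrite eqSS andbCA -IHk.
apply/allpairsP/andP => [[[j u] /= [nj ku [-> ->]]]|[lt_i kt]].
  by rewrite mem_iota in nj.
by exists (i, t); rewrite mem_iota.
Qed.

(** Arguments are positions in an enumeration, not elements; comparing structures of size [n] thus
    takes finitely many fixed tests. *)
Definition rel_atoms (n : nat) : seq (nat * seq nat) :=
  [seq (i, t) | i <- iota 0 (size L), t <- tuples n (nth 0 L i)].

Lemma mem_rel_atoms n i t :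
  ((i, t) \in rel_atoms n) =
  [&& i < size L, size t == nth 0 L i & all (gtn n) t].
Proof.
rewrite -mem_tuples; apply/allpairsPdep/andP => [[j [u [nj ku [-> ->]]]]|[lt_i kt]].
  by rewrite mem_iota in nj.
by exists i, t; rewrite mem_iota.
Qed.

Definition partial_iso n A (s : seq nat) B (z : seq nat) : Prop :=
  forall i t, (i, t) \in rel_atoms n ->
    (srel B i (map (nth 0 z) t) <-> srel A i (map (nth 0 s) t)).

Lemma iso_enumP A B s : enumerates s A ->
  (iso B A <-> exists z, [/\ size z = size s, enumerates z B
                           & partial_iso (size s) A s B z]).
Proof.
move=> [uniq_s sA]; split.
  case=> f [f_dom [f_inj [f_surj f_rel]]].
  (* [z] lists preimages of the entries of [s], found by surjectivity; it has no repetition because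
     its image has none. *)
  have [z Dz zB] : exists2 z, map f z = s & forall x, x \in z -> sdom B x.
    have: forall y, y \in s -> sdom A y by move=> y /sA.
    elim: s {uniq_s sA} => [|y s IHs] sA; first by exists [::].
    have [y' sy'|z Dz zB] := IHs; first by apply: sA; rewrite inE sy' orbT.
    have [x Bx Dx] := f_surj y (sA y (mem_head y s)).
    exists (x :: z); first by rewrite /= Dx Dz.
    by move=> x'; rewrite inE => /predU1P[->|/zB].
  exists z; split; first by rewrite -Dz size_map.
    split=> [|x]; first by apply: (map_uniq (f := f)); rewrite Dz.
    split=> [Bx|/zB //]; have /sA := f_dom x Bx; rewrite -Dz => /mapP[x' zx' Dx].
    by rewrite (f_inj x x') //; apply: zB.
  move=> i t; rewrite mem_rel_atoms => /and3P[lt_i /eqP sz_t lt_t].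
  have zt j : j \in t -> j < size z.
    by move=> tj; have /allP/(_ _ tj) := lt_t; rewrite -Dz size_map.
  rewrite f_rel ?size_map //; last first.
    by move=> x /mapP[j tj ->]; apply/zB/mem_nth/zt.
  suffices -> : map f (map (nth 0 z) t) = map (nth 0 s) t by [].
  rewrite -map_comp; apply/eq_in_map => j /zt lt_j /=.
  by rewrite -Dz (nth_map 0).
case=> z [sz_z [uniq_z zB] zs]; pose f x := nth 0 s (index x z).
have lt_index x : sdom B x -> index x z < size s.
  by move=> /zB; rewrite -index_mem sz_z.
exists f; split=> [x /lt_index lt_x|]; first by apply/sA/mem_nth.
split=> [x y Bx By /eqP|].
  rewrite nth_uniq ?lt_index // => /eqP/(congr1 (nth 0 z)).
  by rewrite !nth_index //; apply/zB.
split=> [y /sA sy|i xs lt_i sz_xs Bxs].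
  have lt_y : index y s < size z by rewrite sz_z index_mem.
  exists (nth 0 z (index y s)); first by apply/zB/mem_nth.
  by rewrite /f index_uniq // nth_index.
have := zs i (map (index^~ z) xs); rewrite mem_rel_atoms lt_i size_map sz_xs eqxx.
rewrite -!map_comp; case=> [|/=].
  by apply/allP => _ /mapP[x /Bxs Bx ->]; apply: lt_index.
have -> : [seq (nth 0 z \o index^~ z) i | i <- xs] = xs.
  rewrite -[RHS]map_id; apply/eq_in_map => x /Bxs/zB zx.
  by rewrite /= nth_index.
by [].
Qed.

Lemma iso_finite A B s : enumerates s A -> iso B A -> finite_str B.
Proof. by move=> sA /(iso_enumP B sA)[z [_ [_ zB] _]]; exists z. Qed.

(* [w] codes a list beginning with [n] distinct elements of the structure with
   index [a]. *)
Definition lists_elements (n a w : nat) : Prop :=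
  forall p, p \in [seq (j, k) | j <- iota 0 n, k <- iota 0 n] ->
    ((p.1 == p.2) ||
      (nth 0 (CodeSeq.decode w) p.1 != nth 0 (CodeSeq.decode w) p.2)) /\
    phi a (pickle (AEq (nth 0 (CodeSeq.decode w) p.1)
                       (nth 0 (CodeSeq.decode w) p.1))) 1.

Lemma lists_elementsP n a w B : is_index a B ->
  (lists_elements n a w <->
   uniq (mkseq (nth 0 (CodeSeq.decode w)) n) /\
   forall x, x \in mkseq (nth 0 (CodeSeq.decode w)) n -> sdom B x).
Proof.
move=> aB; set z := CodeSeq.decode w; split=> [w_n|[uniq_w wB]].
  have {}w_n j k : j < n -> k < n ->
      ((j == k) || (nth 0 z j != nth 0 z k)) /\ sdom B (nth 0 z j).
    move=> lt_j lt_k; rewrite -holds_AEq -(is_index_phi1 _ aB).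
    by apply: (w_n (j, k)); apply/allpairsP; exists (j, k); rewrite !mem_iota.
  split=> [|x /mapP[j]]; last by rewrite mem_iota => lt_j ->; case: (w_n j j).
  rewrite map_inj_in_uniq ?iota_uniq // => j k; rewrite !mem_iota => lt_j lt_k.
  by case: (w_n j k lt_j lt_k) => /orP[/eqP //|/eqP].
move=> _ /allpairsP[[j k] [/= + + ->]]; rewrite !mem_iota !add0n /= => lt_j lt_k.
rewrite (is_index_phi1 _ aB) holds_AEq; split; last first.
  by apply: wB; rewrite map_f // mem_iota.
have := nth_uniq 0 _ _ uniq_w; rewrite size_mkseq => /(_ j k lt_j lt_k).
by rewrite !nth_mkseq // => ->; case: eqP.
Qed.

(** Both truth values are awaited as outputs of the index, so negative facts are semidecidable too.
    The classical truth values of [A] are finitely many constant bits. *)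
Definition lists_copy n A (s : seq nat) (a w : nat) : Prop :=
  forall p, p \in rel_atoms n ->
    phi a (pickle (ARel p.1 [seq nth 0 (CodeSeq.decode w) j | j <- p.2]))
          `[< srel A p.1 [seq nth 0 s j | j <- p.2] >].

Lemma semidecidable_lists_elements n :
  semidecidable (fun p : nat * nat => lists_elements n p.1 p.2).
Proof.
apply: semidecidable_all => -[j k] _; apply: semidecidable_and => /=.
  by apply: semidecidable_computable; computability.
apply: (semidecidable_comp
  (g := fun p : nat * nat => (p.1, (pickle (AEq (nth 0 (CodeSeq.decode p.2) j)
                       (nth 0 (CodeSeq.decode p.2) j)), 1)))) semidecidable_phi.
by under eq_fun do rewrite pickle_AEq; computability.
Qed.

Lemma semidecidable_phi_ARel i (t : seq nat) (b : bool) :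
  semidecidable (fun p : nat * nat =>
    phi p.1 (pickle (ARel i [seq nth 0 (CodeSeq.decode p.2) j | j <- t])) b).
Proof.
apply: (semidecidable_comp (g := fun p : nat * nat =>
   (p.1, (pickle (ARel i [seq nth 0 (CodeSeq.decode p.2) j | j <- t]), nat_of_bool b))))
  semidecidable_phi.
under eq_fun do rewrite pickle_ARel; computability.
by apply: computable_map_cst => j; computability.
Qed.

Definition has_copy n A s a : Prop :=
  exists w, lists_elements n a w /\ lists_copy n A s a w.

Definition has_elements n a : Prop := exists w, lists_elements n a w.

Lemma ce_has_copy n A s : ce (has_copy n A s).
Proof.
apply/ce_semidecidable; apply: (semidecidable_exists (P := fun p =>
  lists_elements n p.1 p.2 /\ lists_copy n A s p.1 p.2)).
apply: semidecidable_and; first exact: semidecidable_lists_elements.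
by apply: semidecidable_all => -[i t] _; apply: semidecidable_phi_ARel.
Qed.

Lemma semidecidable_has_elements n : semidecidable (has_elements n).
Proof.
exact: (semidecidable_exists (P := fun p => lists_elements n p.1 p.2))
  (semidecidable_lists_elements n).
Qed.

Lemma has_elementsP n a B : is_index a B ->
  (has_elements n a <->
   exists z, [/\ uniq z, size z = n & forall x, x \in z -> sdom B x]).
Proof.
move=> aB; split=> [[w /(lists_elementsP _ _ aB)[uniq_w wB]]|[z [uniq_z <- zB]]].
  by eexists; split; [exact: uniq_w | exact: size_mkseq |].
exists (CodeSeq.code z); apply/(lists_elementsP _ _ aB).
by rewrite CodeSeq.codeK mkseq_nth.
Qed.

Lemma lists_copyP n A s a w B : is_index a B ->
  (forall x, x \in mkseq (nth 0 (CodeSeq.decode w)) n -> sdom B x) ->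
  (lists_copy n A s a w <-> partial_iso n A s B (CodeSeq.decode w)).
Proof.
move=> aB wB; have wiP i t : (i, t) \in rel_atoms n ->
    (holds B (ARel i [seq nth 0 (CodeSeq.decode w) j | j <- t])
     <-> srel B i [seq nth 0 (CodeSeq.decode w) j | j <- t]).
  rewrite mem_rel_atoms => /and3P[lt_i /eqP sz_t /allP lt_t].
  split=> [[_ [_ []]] //|Bi]; split=> //; split; first by rewrite size_map.
  by split=> // _ /mapP[j /lt_t lt_j ->]; apply: wB; rewrite map_f // mem_iota.
split=> [wA i t it|wA [i t] it].
  have /(is_index_phi _ _ aB) bP := wA _ it.
  by rewrite -wiP // -bP; split=> /asboolP.
by apply/(is_index_phi _ _ aB); rewrite wiP // wA //; split=> /asboolP.
Qed.

(** The bound on the number of elements forces a copy of [A] inside [B] to exhaust [B]. *)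
Lemma index_setE A s a B : enumerates s A -> is_index a B ->
  (index_set A a <->
   has_copy (size s) A s a /\ ~ has_elements (size s).+1 a).
Proof.
move=> sA aB; rewrite (index_set_iso _ aB) (iso_enumP _ sA).
split=> [[z [sz_z [uniq_z zB] zs]]|[[w [w_el w_copy]] no_el]].
  split.
    exists (CodeSeq.code z).
    have zz : mkseq (nth 0 (CodeSeq.decode (CodeSeq.code z))) (size s) = z.
      by rewrite CodeSeq.codeK -sz_z mkseq_nth.
    have dz x : x \in z -> sdom B x by move=> /zB.
    split; first by apply/(lists_elementsP _ _ aB); rewrite zz.
    by apply/(lists_copyP _ _ aB); rewrite ?zz // CodeSeq.codeK.
  case/(has_elementsP _ aB) => z' [uniq_z' sz_z' z'B].
  have := uniq_leq_size uniq_z' (fun x xz' => (zB x).1 (z'B x xz')).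
  by rewrite sz_z' sz_z ltnn.
have [uniq_z zB] := (lists_elementsP _ _ aB).1 w_el.
set z := mkseq _ _ in uniq_z zB; exists z.
split; [exact: size_mkseq | split=> // x; split=> [Bx|/zB //] |].
  (* An element outside the copy would be one too many. *)
  apply/negPn/negP => nzx; case: no_el; apply/(has_elementsP _ aB).
  exists (x :: z); split; rewrite /= ?nzx ?size_mkseq // => y.
  by rewrite inE => /predU1P[->|/zB].
move=> i t it; have := (lists_copyP _ _ aB zB).1 w_copy i t it.
suffices -> : map (nth 0 z) t = map (nth 0 (CodeSeq.decode w)) t by [].
apply/eq_in_map => j tj; rewrite nth_mkseq //.
by move: it; rewrite mem_rel_atoms => /and3P[_ _ /allP/(_ j tj)].
Qed.

Lemma index_set_in_K A s a : enumerates s A -> index_set A a -> index_set_K L a.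
Proof.
by move=> sA [B [aB BA]]; exists B; split=> //; apply: iso_finite sA BA.
Qed.

(** * Upper bounds within the class of finite structures *)

Lemma within_K_dce A s : enumerates s A -> within_K L dce (index_set A).
Proof.
move=> sA; exists (fun a => has_copy (size s) A s a /\ ~ has_elements (size s).+1 a).
split=> [|a].
  exists (has_copy (size s) A s), (has_elements (size s).+1).
  split; [exact: ce_has_copy | split=> //].
  by apply/ce_semidecidable/semidecidable_has_elements.
split=> [Aa|[Ra [B [_ aB]]]]; last by apply/(index_setE sA aB).
have aK := index_set_in_K sA Aa; split=> //.
by have [B [_ aB]] := aK; apply/(index_setE sA aB).
Qed.

(** Failure is c.e.: either an element shows up, or the index gives the wrong value for a nullary
    relation. *)
Lemma within_K_Pi01 A : empty_str A -> within_K L Pi01 (index_set A).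
Proof.
move=> A0; have sA : enumerates [::] A by split=> // x; split=> // /A0.
pose wrong a w := exists2 p, p \in rel_atoms 0 &
  phi a (pickle (ARel p.1 [seq nth 0 (CodeSeq.decode w) j | j <- p.2]))
        (~~ `[< srel A p.1 [seq nth 0 [::] j | j <- p.2] >]).
pose T a := has_elements 1 a \/ exists w, wrong a w.
have TP a B : is_index a B -> (index_set A a <-> ~ T a).
  move=> aB; rewrite (index_setE sA aB).
  (* There is no position below 0, so only empty tuples occur. *)
  have wP w i t : (i, t) \in rel_atoms 0 ->
      [seq nth 0 (CodeSeq.decode w) j | j <- t] = [::].
    by rewrite mem_rel_atoms => /and3P[_ _]; case: t.
  split=> [[[w [_ w_copy]] no_el] [//|[w' [[i t] it]]]|nT].
    have := w_copy _ it; rewrite /= !(wP _ _ _ it) => ph /(phi_det ph).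
    by case: asbool.
  split=> [|el]; last by apply: nT; left.
  exists 0; split=> // -[i t] it; set b := `[< _ >].
  have [/(is_index_phi _ _ aB) //|nb] :=
    pselect (b <-> holds B (ARel i [seq nth 0 (CodeSeq.decode 0) j | j <- t])).
  (* An index always outputs one of the two truth values; if it is not that of [A], it is the
     opposite one, which [wrong] detects. *)
  case: nT; right; exists 0, (i, t) => //=; rewrite -/b.
  apply/(is_index_phi _ _ aB); move: nb; case: b => nb; split=> //= Bi.
    by case: nb.
  by apply: contrapT => nBi; apply: nb; split.
exists (fun a => ~ T a); split.
  exists T; split=> //; apply/ce_semidecidable.
  apply: semidecidable_or; first exact: semidecidable_has_elements.
  apply: (semidecidable_exists (P := fun p => wrong p.1 p.2)).
  by apply: semidecidable_has => -[i t] _; apply: semidecidable_phi_ARel.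
move=> a; split=> [Aa|[nT [B [_ aB]]]]; last by apply/(TP a B aB).
have aK := index_set_in_K sA Aa; split=> //.
by have [B [_ aB]] := aK; apply/(TP a B aB).
Qed.

End Structures.

(** * Hardness *)

(* The element [npair i t] of the structure attached to [x] plays the role of
   the [i]-th element of the given structure of size [n] and appears at stage
   [t]; the label [n] is that of a spurious extra element. *)
Definition live (n : nat) (f1 f2 : nat * nat -> bool) (p : nat * nat) : bool :=
  if nfst p.2 < n.-1 then nsnd p.2 == 0
  else if (nfst p.2).+1 == n then f1 (p.1, nsnd p.2)
  else (nfst p.2 == n) && f2 (p.1, nsnd p.2).

Lemma computable_live n f1 f2 :
  computable f1 -> computable f2 -> computable (live n f1 f2).
Proof.
move=> c1 c2; rewrite /live; computability.
  by apply: (computable_comp c1); computability.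
by apply: (computable_comp c2); computability.
Qed.

(** The live labels are those below [m], which is [n.-1], [n] or [n.+1] as neither, only the first
    or both of the events occur; [tau] gives the stage of each label. If [n = 0] then [n.-1] is
    already [n], whence the disjunct. *)
Lemma live_initial_segment n (f1 f2 : nat * nat -> bool) x :
  (forall s t, f1 (x, s) -> f1 (x, t) -> s = t) ->
  (forall s t, f2 (x, s) -> f2 (x, t) -> s = t) ->
  ((exists s, f2 (x, s)) -> exists s, f1 (x, s)) ->
  exists m tau,
    (m = n <-> (n = 0 \/ exists s, f1 (x, s)) /\ ~ exists s, f2 (x, s)) /\
    forall y, live n f1 f2 (x, y) = (nfst y < m) && (nsnd y == tau (nfst y)).
Proof.
move=> uniq1 uniq2 f21.
have f1E t s : f1 (x, t) -> f1 (x, s) = (s == t).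
  by move=> ft; apply/idP/eqP => [/uniq1/(_ ft)|->].
have f2E t s : f2 (x, t) -> f2 (x, s) = (s == t).
  by move=> ft; apply/idP/eqP => [/uniq2/(_ ft)|->].
have [[t1 ft1]|no1] := pselect (exists s, f1 (x, s)); last first.
  have no2 : ~ exists s, f2 (x, s) by move=> /f21.
  exists n.-1, (fun=> 0); split.
    by split=> [|[[->|//] _]] //; case: n => [|n] Dn; split=> //; [left | case: (n_Sn n)].
  move=> y; rewrite /live /=; case: ltnP => // _.
  have -> s : f1 (x, s) = false by apply/negP => f1s; apply: no1; exists s.
  have -> s : f2 (x, s) = false by apply/negP => f2s; apply: no2; exists s.
  by rewrite andbF if_same.
have [[t2 ft2]|no2] := pselect (exists s, f2 (x, s)).
  exists n.+1, (fun i => if i < n.-1 then 0 else if i.+1 == n then t1 else t2).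
  split; first by split=> [/esym/n_Sn|[_ []]] //; exists t2.
  move=> y; rewrite /live /=; case: ltnP => lt_y.
    by rewrite ltnS (leq_trans (ltnW lt_y) (leq_pred n)).
  case: eqP => [Dn|nDn]; first by rewrite ltnS -Dn leqnSn (f1E t1).
  rewrite (f2E t2) //; congr andb; rewrite ltnS; apply/eqP/idP => [->//|le_y].
  apply/eqP; rewrite eqn_leq le_y /=.
  (* A label between [n.-1] and [n] whose successor is not [n] can only be [n]. *)
  by move: lt_y le_y nDn; case: (n) => //= n' le1; rewrite leq_eqVlt => /predU1P[->|];
     rewrite // ltnS => le2; case; congr _.+1; apply/eqP; rewrite eqn_leq le1 le2.
exists n, (fun i => if i < n.-1 then 0 else t1).
split; first by split=> // _; split=> //; right; exists t1.
move=> y; rewrite /live /=; case: ltnP => lt_y.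
  by rewrite (leq_trans lt_y (leq_pred n)).
have -> s : f2 (x, s) = false by apply/negP => f2s; apply: no2; exists s.
rewrite andbF; case: eqP => [<-|nDn]; first by rewrite leqnn (f1E t1).
case: ltnP => //= lt_yn; case: nDn; apply/eqP; rewrite eqn_leq lt_yn /=.
by case: (n) lt_y lt_yn => //= n'; rewrite ltnS.
Qed.

Section Hardness.
Variables (L : language) (A : structure L) (s : seq nat).
Hypothesis sA : enumerates s A.

Let n := size s.

(** This finite table is selected classically, but as a constant list it can be built into a
    program. *)
Definition true_atoms : seq (nat * seq nat) :=
  [seq p <- rel_atoms L n | `[< srel A p.1 (map (nth 0 s) p.2) >]].

(** Relations are read off the labels. The label [n] is absent from the table, so no relation holds
    of a tuple containing a spurious element. *)
Definition staged (f1 f2 : nat * nat -> bool) (x : nat) : structure L :=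
  Structure L (live n f1 f2 \o pair x)
    (fun i xs => (i, map nfst xs) \in true_atoms).

(** The nested lists are those of [pickle_AEq]: sum, option, pair. On a number that is no such atom
    the result is a mere guess. *)
Definition AEq_arg (m : nat) : nat :=
  nth 0 (CodeSeq.decode (nth 0 (CodeSeq.decode (nth 0 (CodeSeq.decode m) 0)) 0)) 0.

Definition ARel_args (m : nat) : seq nat :=
  CodeSeq.decode
    (nth 0 (CodeSeq.decode (nth 0 (CodeSeq.decode (nth 0 (CodeSeq.decode m) 1)) 0)) 1).

Lemma AEq_argK x y : AEq_arg (pickle (AEq x y)) = x.
Proof. by rewrite pickle_AEq /AEq_arg; do 3 (rewrite CodeSeq.codeK; cbn [nth]). Qed.

Lemma ARel_argsK i xs : ARel_args (pickle (ARel i xs)) = xs.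
Proof. by rewrite pickle_ARel /ARel_args; do 4 (rewrite CodeSeq.codeK; cbn [nth]). Qed.

(** An atom is recognised by rebuilding it: its arguments are guessed from the number, and the
    pickled candidate is compared with that number. *)
Definition staged_char (f1 f2 : nat * nat -> bool) (p : nat * nat) : bool :=
  (p.2 == pickle (AEq (AEq_arg p.2) (AEq_arg p.2))) &&
    live n f1 f2 (p.1, AEq_arg p.2)
  || has (fun u =>
       (p.2 == pickle (ARel u.1 (mkseq (nth 0 (ARel_args p.2)) (size u.2)))) &&
       all (fun j => live n f1 f2 (p.1, nth 0 (ARel_args p.2) j) &&
                     (nfst (nth 0 (ARel_args p.2) j) == nth 0 u.2 j))
           (iota 0 (size u.2))) true_atoms.

Lemma computable_staged_char f1 f2 :
  computable f1 -> computable f2 -> computable (staged_char f1 f2).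
Proof.
move=> c1 c2; have cl := computable_live n c1 c2.
have live_comp (g : nat * nat -> nat) : computable g ->
    computable (fun p => live n f1 f2 (p.1, g p)).
  by move=> cg; apply: (computable_comp cl); computability.
apply: computable_or.
  apply: computable_and; last by apply: live_comp; rewrite /AEq_arg; computability.
  by under eq_fun do rewrite pickle_AEq; rewrite /AEq_arg; computability.
apply: computable_has_cst => u; apply: computable_and.
  under eq_fun do rewrite pickle_ARel; computability.
  rewrite /mkseq; apply: (computable_map_cst _
    (f := fun j (p : nat * nat) => nth 0 (ARel_args p.2) j)) => j.
  by rewrite /ARel_args; computability.
apply: computable_all_cst => j; apply: computable_and.
  by apply: live_comp; rewrite /ARel_args; computability.
by rewrite /ARel_args; computability.
Qed.

Lemma staged_charP f1 f2 x m :
  staged_char f1 f2 (x, m) <-> diagram (staged f1 f2 x) m.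
Proof.
split=> [/orP[/andP[/eqP /= -> lv]|/hasP[[i t] it /andP[/eqP /= -> /allP lv]]]|].
- by exists (AEq (AEq_arg m) (AEq_arg m)); rewrite AEq_argK in lv *.
- set xs := mkseq _ _; exists (ARel i xs); split=> //.
  have {}lv j : j < size t -> live n f1 f2 (x, nth 0 (ARel_args m) j) /\
      nfst (nth 0 (ARel_args m) j) = nth 0 t j.
    move=> lt_j; have := lv j; rewrite mem_iota lt_j ARel_argsK.
    by case/(_ isT)/andP; rewrite nth_mkseq // => -> /eqP.
  have Dt : map nfst xs = t.
    apply: (@eq_from_nth _ 0); first by rewrite size_map size_mkseq.
    move=> j; rewrite size_map size_mkseq => lt_j.
    by rewrite (nth_map 0) ?size_mkseq // nth_mkseq //; case: (lv j).
  move: (it); rewrite mem_filter mem_rel_atoms /= => /and4P[_ lt_i /eqP sz_t _].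
  rewrite size_mkseq Dt; split=> //; split=> //; split=> // y /mapP[j].
  by rewrite mem_iota => lt_j ->; case: (lv j).
case=> -[y y'|i xs] [<-] /=.
  by case=> lv [_ <-]; rewrite /staged_char /= AEq_argK eqxx lv.
case=> lt_i [sz_xs [lv it]]; apply/orP; right; apply/hasP.
exists (i, map nfst xs) => //=; rewrite size_map ARel_argsK mkseq_nth eqxx /=.
apply/allP => j; rewrite mem_iota add0n /= => lt_j.
by rewrite (nth_map 0) // eqxx andbT; apply/lv/mem_nth.
Qed.

Lemma staged_index f1 f2 : computable f1 -> computable f2 ->
  exists2 h, computable_fun h & forall x, is_index (h x) (staged f1 f2 x).
Proof.
move=> c1 c2; have [c cP] := computable_staged_char c1 c2.
exists (fun x => pickle (specialize c x)).
  have [d dP] := computable_specialize c.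
  by exists (pickle d) => x; rewrite /phi pickleK; apply: dP.
move=> x m; rewrite /phi pickleK /= -(staged_charP f1 f2 x m).
have {cP} := peval_specialize (cP (x, m)).
by rewrite /enc /encoding_bool; case: staged_char => ev; split.
Qed.

(** The element with label [i] is [npair i (tau i)]. Counting forces [m = n] in one direction; in
    the other, each label is matched with that position in [s]. *)
Lemma staged_iso f1 f2 x m tau :
  (forall y, live n f1 f2 (x, y) = (nfst y < m) && (nsnd y == tau (nfst y))) ->
  finite_str (staged f1 f2 x) /\ (iso (staged f1 f2 x) A <-> m = n).
Proof.
move=> liveE; pose z := mkseq (fun i => npair i (tau i)) m.
have z_fst t : all (gtn m) t -> map nfst (map (nth 0 z) t) = t.
  move=> /allP lt_t; rewrite -map_comp -[RHS]map_id.
  by apply/eq_in_map => j /lt_t lt_j; rewrite /= nth_mkseq // nfst_npair.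
have zC : enumerates z (staged f1 f2 x).
  split=> [|y].
    apply: (map_uniq (f := nfst)); rewrite -map_comp.
    rewrite (eq_map (g := id)) ?map_id ?iota_uniq // => i.
    by rewrite /= nfst_npair.
  rewrite /= liveE; split=> [/andP[lt_y /eqP Dy]|/mapP[i]].
    by apply/mapP; exists (nfst y); rewrite ?mem_iota // -Dy npair_eta.
  by rewrite mem_iota => lt_i ->; rewrite nfst_npair nsnd_npair eqxx andbT.
split; first by exists z; case: zC.
rewrite (iso_enumP _ sA); split=> [[z' [sz_z' [uniq_z' z'C] _]]|Dm].
  rewrite /n -sz_z' -(size_mkseq (fun i => npair i (tau i)) m).
  apply/perm_size/uniq_perm => //; first by case: zC.
  by move=> y; apply/idP/idP => [/zC.2/z'C|/z'C/zC.2].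
exists z; split=> //; first by rewrite size_mkseq.
move=> i t it /=; move: (it); rewrite mem_rel_atoms => /and3P[_ _ lt_t].
rewrite z_fst ?Dm // mem_filter it andbT.
by split=> [/asboolP|?] //; apply/asboolP.
Qed.

(** The inclusion of [P2] in [P1] prevents the extra element from appearing without the last element
    of [A]. First-stage searches make each of them appear only once. *)
Lemma hardness (P1 P2 : nat -> Prop) :
  semidecidable P1 -> semidecidable P2 -> (forall x, P2 x -> P1 x) ->
  exists h, [/\ computable_fun h, forall x, index_set_K L (h x)
    & forall x, index_set A (h x) <-> (n = 0 \/ P1 x) /\ ~ P2 x].
Proof.
move=> /semidecidable_unique[f1 [c1 f1P u1]] /semidecidable_unique[f2 [c2 f2P u2]].
move=> P21; have [h ch hP] := staged_index c1 c2.
have f21 x : (exists s, f2 (x, s)) -> exists s, f1 (x, s).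
  by rewrite -f2P -f1P; apply: P21.
exists h; split=> // x;
  have [m [tau [Dm liveE]]] := live_initial_segment n (u1 x) (u2 x) (@f21 x);
  have [finC isoC] := staged_iso liveE.
  by exists (staged f1 f2 x).
by rewrite (index_set_iso _ (hP x)) isoC Dm f1P f2P.
Qed.

End Hardness.

Theorem theorem2p1 (L : language) (A : structure L) :
  finite_str A ->
  (empty_str A -> m_complete_within_K L Pi01 (index_set A)) /\
  (forall n, 1 <= n -> has_size A n -> m_complete_within_K L dce (index_set A)).
Proof.
move=> _; split=> [A0|n n_gt0 [s [uniq_s sz_s sA]]].
  split=> [|S [T [/ce_semidecidable sT ST]]]; first exact: within_K_Pi01.
  have sA : enumerates [::] A by split=> // x; split=> // /A0.
  (* Both sets are taken to be [T]: since [s] is empty, the first condition holds by its left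
     disjunct and only the complement of [T] remains. *)
  have [h [ch hK hA]] := hardness sA sT sT (fun _ => id).
  by exists h; split=> // x; rewrite hA ST; split=> [nT|[]] //; split=> //; left.
have eA : enumerates s A by [].
split=> [|S [S1 [S2 [/ce_semidecidable s1 [/ce_semidecidable s2 SE]]]]].
  exact: within_K_dce eA.
(* Intersecting [S2] with [S1] keeps the difference and secures the inclusion. *)
have [h [ch hK hA]] := hardness eA s1 (semidecidable_and s1 s2) (fun _ => @proj1 _ _).
exists h; split=> // x; rewrite hA SE sz_s.
split=> [[S1x nS2]|[[n0|S1x] nS]]; first by split; [right | case].
  by rewrite n0 in n_gt0.
by split=> // S2x; apply: nS.
Qed.
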